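(* Let $p>3$ be a prime and consider the exterior algebra $E[h_{2,j},h_{3,j},h_{4,j},h_{5,j}\mid j\in\mathbb{Z}/4]$ over $\mathbb{Z}/p$ with the differential $d$ (a graded derivation, all $h$'s of degree 1) determined by $d(h_{2,j})=d(h_{3,j})=0$, $d(h_{4,j})=-h_{2,j}h_{2,j+2}$, $d(h_{5,j})=-(h_{2,j}h_{3,j+2}+h_{3,j}h_{2,j+3})$ (indices mod 4). Its cohomology has Poincaré series $$(1+t)^4(1+6t+18t^2+59t^3+92t^4+176t^5+161t^6+176t^7+92t^8+59t^9+18t^{10}+6t^{11}+t^{12}).$$ In particular, the ranks in cohomological dimensions $0,1,2,\dots,9$ are $1,10,48,171,461,976,1671,2303,2558,2303$, and the rank in dimension $16$ is $1$.
   Context: This differential graded algebra is the reduced first May $E_1$-term, with its first May differential, of the May spectral sequence for the Hopf algebra $S(4,2)=\mathbb{Z}/p[t_2,t_3,\dots]/(t_s^{p^4}-t_s)$ at primes $p\geq 5$; its cohomology is the May $E_2$-term for $\mathrm{Ext}_{S(4,2)}(\mathbb{Z}/p,\mathbb{Z}/p)$. Only the algebraic description above is needed. *)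

(* Defs.v *)
From HB Require Import structures.
From mathcomp Require Import all_boot all_order all_algebra.
Set Implicit Arguments. Unset Strict Implicit. Unset Printing Implicit Defensive.
Import GRing.Theory.
Local Open Scope ring_scope.

(* Exterior algebra E[h_{a,j} | a in {2,3,4,5}, j in Z/4] over a field F.
   The 16 generators are indexed by k : 'I_16, with k = 4*(a-2) + j
   (so k %/ 4 = a - 2 and k %% 4 = j); the total order on generators used
   for the sign conventions is the order of 'I_16.
   An element of the exterior algebra is the family of its coefficients on the
   standard basis e_S = h_{k_1} ... h_{k_m} (k_1 < ... < k_m), S = {k_1..k_m}. *)

Definition gidx := 'I_16.
Definition ext (F : fieldType) := {ffun {set gidx} -> F^o}.

Definition ebasis (F : fieldType) (S : {set gidx}) : ext F :=
  [ffun T => ((T == S)%:R : F)].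

(* number of inversions between S and T : e_S e_T = (-1)^inv e_{S u T} *)
Definition inv_count (S T : {set gidx}) : nat :=
  #|[set st in setX S T | (st.2 < st.1)%N]|.

Definition wedge (F : fieldType) (x y : ext F) : ext F :=
  [ffun U => \sum_(S : {set gidx}) \sum_(T : {set gidx})
     (if [disjoint S & T] && (S :|: T == U)
      then (-1) ^+ inv_count S T * x S * y T else 0)].

(* h a j = h_{a+2, j mod 4}, for a = 0,1,2,3 *)
Definition h (F : fieldType) (a j : nat) : ext F :=
  ebasis F [set (inord (4 * a + j %% 4) : gidx)].

Definition dgen (F : fieldType) (k : gidx) : ext F :=
  let a := (k %/ 4)%N in let j := (k %% 4)%N in
  if a == 2 then - wedge (h F 0 j) (h F 0 (j + 2))
  else if a == 3 then
    - (wedge (h F 0 j) (h F 1 (j + 2)) + wedge (h F 1 j) (h F 0 (j + 3)))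
  else 0.

(* graded derivation on a basis monomial:
   d(g_1...g_m) = sum_i (-1)^(i-1) g_1..d(g_i)..g_m
                = sum_i (-1)^(i-1) d(g_i) g_1..^g_i..g_m   (d(g_i) has even degree) *)
Definition dbasis (F : fieldType) (S : {set gidx}) : ext F :=
  \sum_(k in S) ((-1) ^+ #|[set s in S | (s < k)%N]| : F)
                  *: wedge (dgen F k) (ebasis F (S :\ k)).

Definition dfun (F : fieldType) (x : ext F) : ext F :=
  \sum_(S : {set gidx}) x S *: dbasis F S.

Definition dlin (F : fieldType) : 'End(ext F) := linfun (@dfun F).

Definition Vdeg (F : fieldType) (n : nat) : {vspace ext F} :=
  <<[seq ebasis F A | A <- enum [set A : {set gidx} | #|A| == n]]>>%VS.

(* cocycles and coboundaries in degree n (d is homogeneous of degree +1) *)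
Definition cocycles (F : fieldType) (n : nat) : {vspace ext F} :=
  (lker (dlin F) :&: Vdeg F n)%VS.
Definition coboundaries (F : fieldType) (n : nat) : {vspace ext F} :=
  (limg (dlin F) :&: Vdeg F n)%VS.

Definition coh_dim (F : fieldType) (n : nat) : nat :=
  (\dim (cocycles F n) - \dim (coboundaries F n))%N.

(* Poincare polynomial (all degrees > 16 vanish) *)
Definition poincare (F : fieldType) : {poly int} :=
  \sum_(n < 17) (coh_dim F n)%:R *: 'X^n.

(* Main.v *)
(* The rank r_n of d on the degree n part is the same over every field of
   characteristic other than 2: integral Gaussian elimination on the images of
   the basis monomials only ever meets pivots dividing 16, so it stays valid
   after reduction to the field.  Then dim H^n = C(16, n) - r_n - r_(n-1). *)
Require Import Defs.
From Stdlib Require Import ZArith FMapPositive.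
From HB Require Import structures.
From mathcomp Require Import all_boot all_order all_algebra.
From mathcomp Require Import ssrZ zify ring.
Set Implicit Arguments. Unset Strict Implicit. Unset Printing Implicit Defensive.
Import GRing.Theory.
Local Open Scope ring_scope.

(** * Coefficients, graded pieces and products of monomials *)

Section ExteriorAlgebra.
Variable F : fieldType.
Implicit Types (x y z : ext F) (S T : {set gidx}).

Lemma ebasisE S T : ebasis F S T = (T == S)%:R.
Proof. by rewrite ffunE. Qed.

Lemma ext_sum_ebasis x : x = \sum_S x S *: ebasis F S.
Proof.
apply/ffunP=> T; rewrite sum_ffunE (bigD1 T) //= big1 ?addr0.
  by rewrite ffunE ebasisE eqxx [_ *: _]mulr1.
by move=> S neST; rewrite ffunE ebasisE eq_sym (negPf neST) [_ *: _]mulr0.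
Qed.

Lemma span_coef_eq0 (X : seq (ext F)) T x :
  (forall y, y \in X -> y T = 0) -> x \in <<X>>%VS -> x T = 0.
Proof.
move=> X0 /(@coord_span _ _ _ (in_tuple X)) ->.
rewrite sum_ffunE big1 // => i _; rewrite ffunE X0 ?[_ *: _]mulr0 //.
by rewrite mem_nth.
Qed.

(** The coordinate at [T] vanishes on the span of [X] but not at [x]. This triangularity criterion
    gives the freeness of the monomials and, later, of the pivot rows. *)
Lemma free_cons_coef (X : seq (ext F)) T x :
  x T != 0 -> (forall y, y \in X -> y T = 0) -> free X -> free (x :: X).
Proof.
move=> xT X0 fX; rewrite free_cons fX andbT.
by apply: contra xT => xX; rewrite (span_coef_eq0 X0).
Qed.

Lemma free_ebasis (s : seq {set gidx}) : uniq s -> free (map (ebasis F) s).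
Proof.
elim: s => [|S s IHs] /=; first by rewrite nil_free.
case/andP=> sS /IHs; apply: (@free_cons_coef _ S).
  by rewrite ebasisE eqxx oner_eq0.
move=> _ /mapP[T sT ->]; rewrite ebasisE; case: eqP => // eST.
by rewrite eST sT in sS.
Qed.

Lemma dim_Vdeg n : \dim (Vdeg F n) = 'C(16, n).
Proof.
rewrite /Vdeg; set s := map _ _.
have /eqP -> : free s by apply/free_ebasis/enum_uniq.
rewrite size_map -cardE.
by rewrite -[in RHS](card_ord 16) card_draws.
Qed.

Lemma mem_Vdeg n x :
  reflect (forall T, #|T| != n -> x T = 0) (x \in Vdeg F n).
Proof.
apply: (iffP idP) => [xV T nT | x0].
  apply: span_coef_eq0 xV => _ /mapP[S + ->].
  rewrite mem_enum inE => /eqP nS; rewrite ebasisE; case: eqP => // eTS.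
  by rewrite eTS nS eqxx in nT.
rewrite (ext_sum_ebasis x) memv_suml // => S _.
have [nS | /x0->] := eqVneq #|S| n; last by rewrite scale0r mem0v.
by rewrite memvZ // memv_span // map_f // mem_enum inE nS.
Qed.

Lemma wedgeE x y U :
  wedge x y U = \sum_(S : {set gidx}) \sum_(T : {set gidx})
    (if [disjoint S & T] && (S :|: T == U)
     then (-1) ^+ inv_count S T * x S * y T else 0).
Proof. by rewrite ffunE. Qed.

Lemma wedge_suml I (r : seq I) (P : pred I) (f : I -> ext F) y :
  wedge (\sum_(i <- r | P i) f i) y = \sum_(i <- r | P i) wedge (f i) y.
Proof.
apply/ffunP=> U; rewrite sum_ffunE wedgeE.
rewrite [RHS](eq_bigr _ (fun i _ => wedgeE (f i) y U)).
rewrite [RHS]exchange_big /=; apply: eq_bigr => S _.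
rewrite [RHS]exchange_big /=; apply: eq_bigr => T _.
case: ifP => _; last by rewrite big1.
by rewrite sum_ffunE mulr_sumr mulr_suml.
Qed.

Lemma wedgeZl (a : F) x y : wedge (a *: x) y = a *: wedge x y.
Proof.
apply/ffunP=> U; rewrite [RHS]ffunE !wedgeE scaler_sumr; apply: eq_bigr => S _.
rewrite scaler_sumr; apply: eq_bigr => T _.
case: ifP => _; last by rewrite scaler0.
by rewrite ffunE /= /GRing.scale /= !mulrA [_ * a]mulrC.
Qed.

Lemma wedgeNl x y : wedge (- x) y = - wedge x y.
Proof. by rewrite -scaleN1r wedgeZl scaleN1r. Qed.

Lemma wedge_ebasis S T :
  wedge (ebasis F S) (ebasis F T) =
  if [disjoint S & T] then (-1) ^+ inv_count S T *: ebasis F (S :|: T) else 0.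
Proof.
apply/ffunP=> U; rewrite wedgeE (bigD1 S) //= [X in _ + X]big1 ?addr0; last first.
  move=> S' neS; rewrite big1 // => T' _; case: ifP => // _.
  by rewrite ebasisE (negPf neS) mulr0 mul0r.
rewrite (bigD1 T) //= [X in _ + X]big1 ?addr0; last first.
  move=> T' neT; case: ifP => // _; by rewrite [X in _ * X]ebasisE (negPf neT) mulr0.
rewrite !ebasisE !eqxx !mulr1; case: ifP => [/andP[-> /eqP eU] | ].
  by rewrite ffunE ebasisE eU eqxx [_ *: _]mulr1.
case: ifP => /= _ neU; last by rewrite ffunE.
by rewrite ffunE ebasisE eq_sym neU [_ *: _]mulr0.
Qed.

End ExteriorAlgebra.

(** * The differential on monomials and the dimension count *)

(* (k, i, j) stands for a summand - g_i g_j of d(g_k). *)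
Definition triples : seq (nat * nat * nat) :=
  [:: (8, 0, 2); (9, 1, 3); (10, 2, 0); (11, 3, 1);
      (12, 0, 6); (12, 4, 3); (13, 1, 7); (13, 5, 0);
      (14, 2, 4); (14, 6, 1); (15, 3, 5); (15, 7, 2)]%N.

Definition below (i : gidx) (T : {set gidx}) : nat := #|[set t in T | (t < i)%N]|.

Lemma inv_countE S T : inv_count S T = (\sum_(s in S) below s T)%N.
Proof.
rewrite /inv_count -sum1_card.
under [RHS]eq_bigr => s _ do rewrite /below -sum1_card.
rewrite pair_big_dep; apply: eq_bigl => -[s t].
by rewrite !inE /= andbA.
Qed.

Section Differential.
Variable F : fieldType.
Implicit Types (x y z : ext F) (S T : {set gidx}).

(** The sign collects [below k S] from the derivation rule, [below i S + below j S] from moving the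
    two new generators into place, [j < i] from ordering them, and [1] from the minus sign in
    d(g_k). *)
Definition dterm (t : nat * nat * nat) S : ext F :=
  let k : gidx := inord t.1.1 in let i : gidx := inord t.1.2 in
  let j : gidx := inord t.2 in
  if [&& k \in S, i \notin S & j \notin S] then
    (-1) ^+ (below k S + below i S + below j S + (j < i) + 1)
      *: ebasis F (i |: (j |: S :\ k))
  else 0.

(** With [G] abstract, the check over the 16 values of [k] only compares indices and never unfolds
    [wedge]. *)
Lemma triples_sumE (V : zmodType) (G : nat -> nat -> V) (k : gidx)
    (a := (k %/ 4)%N) (j := (k %% 4)%N) :
  (if a == 2 then - G (4 * 0 + j %% 4)%N (4 * 0 + (j + 2) %% 4)%N
   else if a == 3 then - (G (4 * 0 + j %% 4)%N (4 * 1 + (j + 2) %% 4)%N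
                         + G (4 * 1 + j %% 4)%N (4 * 0 + (j + 3) %% 4)%N)
   else 0) = - \sum_(t <- triples | t.1.1 == k) G t.1.2 t.2.
Proof.
rewrite -big_filter {}/a {}/j; case: k => k lt_k; rewrite [nat_of_ord _]/=.
do 16?[case: k lt_k => [_|k lt_k];
  first by rewrite /= ?big_cons big_nil ?addr0 ?oppr0].
by [].
Qed.

Lemma dgenE (k : gidx) :
  dgen F k = - \sum_(t <- triples | t.1.1 == k)
                 wedge (ebasis F [set inord t.1.2]) (ebasis F [set inord t.2]).
Proof.
exact: (triples_sumE (fun i j => wedge (ebasis F [set inord i]) (ebasis F [set inord j]))).
Qed.

(** Since [i] and [j] lie below [k], deleting [k] from [S] does not change how many elements lie
    below them, so the sign can be read off from [S] itself. *)
Lemma wedge_quadratic (i j k : gidx) S :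
    i != j -> (i < k)%N -> (j < k)%N ->
  wedge (wedge (ebasis F [set i]) (ebasis F [set j])) (ebasis F (S :\ k)) =
  if (i \notin S) && (j \notin S) then
    (-1) ^+ (below i S + below j S + (j < i)) *: ebasis F (i |: (j |: S :\ k))
  else 0.
Proof.
move=> neq_ij lt_ik lt_jk.
have below_rem (l : gidx) : (l < k)%N -> below l (S :\ k) = below l S.
  move=> lt_lk; apply: eq_card => s; rewrite !inE.
  by case: eqP => // -> /=; rewrite ltnNge (ltnW lt_lk) andbF.
have inv_ij : inv_count [set i] [set j] = (j < i)%N.
  rewrite inv_countE big_set1 /below.
  have [lt_ji | le_ij] := ltnP j i.
    by apply/eqP/cards1P; exists j; apply/setP=> s; rewrite !inE; case: eqP => // ->.
  apply: eq_card0 => s; rewrite !inE; case: eqP => //= ->.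
  by rewrite ltnNge le_ij.
rewrite wedge_ebasis disjoints1 inE neq_ij inv_ij wedgeZl wedge_ebasis.
rewrite disjoints_subset subUset !sub1set !inE.
have [-> ->] : i != k /\ j != k.
  by split; rewrite -val_eqE /= neq_ltn ?lt_ik ?lt_jk.
rewrite -setUA; case: ifP => _ /=; last by rewrite scaler0.
rewrite scalerA -exprD inv_countE big_setU1 ?inE // big_set1 !below_rem //.
by rewrite addnC.
Qed.

Lemma dbasisE S : dbasis F S = \sum_(t <- triples) dterm t S.
Proof.
rewrite /dbasis.
under eq_bigr => k _ do rewrite dgenE wedgeNl wedge_suml -sumrN scaler_sumr.
rewrite (exchange_big_dep predT) //=; apply: eq_big_seq => -[[k i] j] t_in.
have /and4P[lt_k lt_ik lt_jk neq_ij] : [&& k < 16, i < k, j < k & i != j]%N.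
  pose P (t : nat * nat * nat) := [&& t.1.1 < 16, t.1.2 < t.1.1, t.2 < t.1.1 & t.1.2 != t.2]%N.
  by have /allP/(_ _ t_in) : all P triples by [].
rewrite /dterm /=.
have eq_k (l : gidx) : (k == l :> nat) = (l == inord k :> gidx).
  by rewrite -val_eqE /= inordK // eq_sym.
case: (boolP (inord k \in S)) => Sk /=; last first.
  by rewrite big1 // => l /andP[+]; rewrite eq_k => + /eqP eq_l; rewrite eq_l (negPf Sk).
rewrite (big_pred1 (inord k)); last first.
  by move=> l; rewrite /= eq_k; case: eqP => [->|]; rewrite ?Sk ?andbF.
have [lt_i lt_j] : (i < 16)%N /\ (j < 16)%N by split; apply: ltn_trans lt_k.
rewrite wedge_quadratic ?inordK // -?val_eqE /= ?inordK //.
case: ifP => _; last by rewrite oppr0 scaler0.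
rewrite -scaleNr scalerA mulrN -exprD addn1 exprS mulN1r !addnA.
by rewrite [below (inord k) S]/below inordK.
Qed.

(** A nonzero term trades one generator [k] of [S] for two distinct generators outside [S]. *)
Lemma dterm_homog t S T :
  t \in triples -> #|T| != #|S|.+1 -> dterm t S T = 0.
Proof.
case: t => [[k i] j] t_in neqTS; rewrite /dterm /=.
case: ifP => [/and3P[Sk Si Sj] | _]; last by rewrite ffunE.
rewrite ffunE ebasisE; case: eqP => [eqT | _]; last by rewrite [_ *: _]mulr0.
have neq_ij : inord i != inord j :> gidx.
  pose P (t : nat * nat * nat) := [&& t.1.2 < 16, t.2 < 16 & t.1.2 != t.2]%N.
  have /allP/(_ _ t_in)/and3P[lt_i lt_j] : all P triples by [].
  by rewrite -val_eqE /= !inordK.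
case/eqP: neqTS; rewrite eqT !cardsU1 !inE (negPf neq_ij) (negPf Si) (negPf Sj) !andbF.
by rewrite (cardsD1 (inord k) S) Sk.
Qed.

Lemma dfun_is_linear : linear (@dfun F).
Proof.
move=> a x y; rewrite /dfun scaler_sumr -big_split; apply: eq_bigr => S _ /=.
by rewrite !ffunE scalerDl scalerA.
Qed.

(** [linfun] accepts any function; it agrees with [dfun] only through this linearity instance. *)
HB.instance Definition _ :=
  GRing.isLinear.Build F (ext F) (ext F) *:%R (@dfun F) dfun_is_linear.

Lemma dlinE x : dlin F x = dfun x.
Proof. exact: lfunE. Qed.

Lemma dfun_ebasis S : dfun (ebasis F S) = dbasis F S.
Proof.
rewrite /dfun (bigD1 S) //= big1 ?addr0; first by rewrite ebasisE eqxx scale1r.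
by move=> T neq_TS; rewrite ebasisE (negPf neq_TS) scale0r.
Qed.

Lemma dfunE x T : dfun x T = \sum_(S : {set gidx} | #|T| == #|S|.+1) x S * dbasis F S T.
Proof.
rewrite /dfun sum_ffunE big_mkcond [RHS]big_mkcond; apply: eq_bigr => S _ /=.
rewrite ffunE; case: eqP => // /eqP neq_TS; rewrite dbasisE sum_ffunE big1_seq ?[_ *: _]mulr0 //.
by move=> t /andP[_ t_in]; apply: dterm_homog.
Qed.

Lemma dlin_Vdeg n : (dlin F @: Vdeg F n <= Vdeg F n.+1)%VS.
Proof.
apply/subvP=> _ /memv_imgP[x /mem_Vdeg x0 ->]; apply/mem_Vdeg => T neq_T.
rewrite dlinE dfunE big1 // => S /eqP eq_T; rewrite x0 ?mul0r //.
by apply: contra neq_T; rewrite eq_T eqSS.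
Qed.

Lemma coboundaries0 : coboundaries F 0 = 0%VS.
Proof.
apply/eqP; rewrite -subv0; apply/subvP=> x; rewrite memv_cap memv0.
case/andP=> /memv_imgP[y _ ->] /mem_Vdeg x0; apply/eqP/ffunP=> T.
rewrite [RHS]ffunE; have [T0 | /x0 //] := eqVneq #|T| 0%N.
by rewrite dlinE dfunE big1 // T0.
Qed.

(** As d raises degree by one, an image lying in degree n+1 is already the image of the degree n
    component of its preimage; [z] below is that component. *)
Lemma coboundariesS n : coboundaries F n.+1 = (dlin F @: Vdeg F n)%VS.
Proof.
apply/subv_anti/andP; split; last by rewrite subv_cap limgS ?subvf ?dlin_Vdeg.
apply/subvP=> x; rewrite memv_cap => /andP[/memv_imgP[y _ ->] /mem_Vdeg x0].
pose z : ext F := [ffun S : {set gidx} => if #|S| == n then y S else 0].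
have -> : dlin F y = dlin F z.
  apply/ffunP=> T; have [nT | nT] := eqVneq #|T| n.+1.
    rewrite !dlinE !dfunE; apply: eq_bigr => S; rewrite nT eqSS ffunE eq_sym.
    by move=> ->.
  rewrite x0 // dlinE dfunE big1 // => S /eqP eq_T; rewrite ffunE.
  by rewrite eq_T eqSS in nT; rewrite (negPf nT) mul0r.
by rewrite memv_img //; apply/mem_Vdeg => T /negPf nT; rewrite ffunE nT.
Qed.

Definition drank n := \dim (dlin F @: Vdeg F n).

(** Rank-nullity for d restricted to degree n. *)
Lemma dim_cocycles n : \dim (cocycles F n) = ('C(16, n) - drank n)%N.
Proof.
by rewrite -(dim_Vdeg F n) -(limg_ker_dim (dlin F) (Vdeg F n)) addnK capvC.
Qed.

Lemma coh_dim0 : coh_dim F 0 = ('C(16, 0) - drank 0)%N.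
Proof. by rewrite /coh_dim dim_cocycles coboundaries0 dimv0 subn0. Qed.

Lemma coh_dimS n : coh_dim F n.+1 = ('C(16, n.+1) - drank n.+1 - drank n)%N.
Proof. by rewrite /coh_dim dim_cocycles coboundariesS. Qed.

End Differential.

(** * Sparse integer vectors and fraction-free elimination *)

(* A monomial is coded by a bit list of length 16, or by a positive number whose
   leading 1 marks the end of that list (least significant bit first). *)
Fixpoint bits (k : positive) : bitseq :=
  match k with xH => [::] | xO k' => false :: bits k' | xI k' => true :: bits k' end.

Fixpoint key (b : bitseq) : positive :=
  match b with [::] => xH | x :: b' => if x then xI (key b') else xO (key b') end.

Lemma keyK : cancel key bits.
Proof. by elim=> //= -[] b /= ->. Qed.

Lemma bitsK : cancel bits key.
Proof. by elim=> //= k ->. Qed.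

HB.instance Definition _ := Countable.copy positive (can_type bitsK).

Definition set_of_bits (b : bitseq) : {set gidx} := [set i : gidx | nth false b i].

(** Missing bits read as [false] and bits beyond the sixteenth are ignored, so injectivity needs the
    fixed length; this is why [pivot] tests the length of every key. *)
Lemma set_of_bits_inj b c :
  size b = 16%N -> size c = 16%N -> set_of_bits b = set_of_bits c -> b = c.
Proof.
move=> sb sc eq_bc; apply: (@eq_from_nth _ false) => [|i]; rewrite ?sb ?sc // => lt_i.
by have /setP/(_ (Ordinal lt_i)) := eq_bc; rewrite !inE.
Qed.

Definition svec := seq (positive * Z).

Fixpoint scale (a : Z) (v : svec) : svec :=
  match v with [::] => [::] | (k, c) :: v' => (k, Z.mul a c) :: scale a v' end.

(* Computes a v + b w; the result is sorted by keys when v and w are, but the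
   semantics below does not need it. *)
Fixpoint lin (a : Z) (v : svec) (b : Z) : svec -> svec :=
  match v with
  | [::] => scale b
  | (k, c) :: v' =>
    (fix lin_v (w : svec) : svec :=
       match w with
       | [::] => scale a v
       | (l, e) :: w' =>
         match Pos.compare k l with
         | Lt => (k, Z.mul a c) :: lin a v' b w
         | Gt => (l, Z.mul b e) :: lin_v w'
         | Eq => match Z.add (Z.mul a c) (Z.mul b e) with
                 | Z0 => lin a v' b w'
                 | s => (k, s) :: lin a v' b w'
                 end
         end
       end)
  end.

Definition unit2 (c : Z) : bool := Z.eqb (Z.modulo (Zpos 16) c) Z0.

Definition lead (v : svec) : positive := if v is (k, _) :: _ then k else xH.

(** All that freeness requires of a row is tested at run time, so no invariant of [lin] or [reduce]
    about sorted keys has to be proved. *)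
Definition pivot (v : svec) : bool :=
  if v is (k, c) :: t then
    [&& unit2 c, all (fun q => Pos.ltb k q.1) t & all (fun q => size (bits q.1) == 16) v]
  else false.

(* Running out of fuel is harmless: it can only make [insert] fail. *)
Fixpoint reduce (fuel : nat) (P : PositiveMap.t svec) (v : svec) : svec :=
  if fuel is f.+1 then
    if v is (k, c) :: _ then
      if PositiveMap.find k P is Some w then
        if w is (_, c') :: _ then reduce f P (lin c' v (Z.opp c) w) else v
      else v
    else v
  else v.

Definition state := (PositiveMap.t svec * seq svec)%type.

Definition insert (st : state) (v : svec) : option state :=
  let w := reduce 1000 st.1 v in
  if w is [::] then Some st
  else if pivot w && (if PositiveMap.find (lead w) st.1 is None then true else false)
  then Some (PositiveMap.add (lead w) w st.1, w :: st.2) else None.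

Fixpoint insert_all (st : state) (vs : seq svec) : option state :=
  if vs is v :: vs' then
    if insert st v is Some st' then insert_all st' vs' else None
  else Some st.

(** The map serves for lookup by leading key, the list for spans and for counting; both must hold
    the same rows, with distinct leading keys. *)
Definition coherent (st : state) : Prop :=
  [/\ forall k w, PositiveMap.find k st.1 = Some w -> w \in st.2,
      forall w, w \in st.2 -> PositiveMap.find (lead w) st.1 = Some w,
      all pivot st.2 & uniq (map lead st.2)].

(** * Correctness of the elimination in characteristic other than 2 *)

Section Elimination.
Variable F : fieldType.
Hypothesis F2 : 2%:R != 0 :> F.

Definition zF (z : Z) : F := (int_of_Z z)%:~R.

Lemma zFD a b : zF (Z.add a b) = zF a + zF b.
Proof. by rewrite /zF -rmorphD -(rmorphD int_of_Z). Qed.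

Lemma zFM a b : zF (Z.mul a b) = zF a * zF b.
Proof. by rewrite /zF -rmorphM -(rmorphM int_of_Z). Qed.

(** A divisor of 16 is nonzero in [F] because 16 is the fourth power of 2, which is nonzero
    there. *)
Lemma unit2_neq0 c : unit2 c -> zF c != 0.
Proof.
move=> /Z.eqb_spec c16; have eq16 : Zpos 16 = Z.mul c (Z.div (Zpos 16) c).
  (* By convention [Z.modulo 16 0] is 16, so zero fails the test. *)
  have [c0 | c0] := Z.eq_dec c Z0; first by rewrite c0 in c16.
  by rewrite {1}(Z.div_mod (Zpos 16) c c0) c16 Z.add_0_r.
have : zF (Zpos 16) != 0 by rewrite (_ : zF (Zpos 16) = 2%:R ^+ 4) ?expf_neq0 // -natrX.
by rewrite eq16 zFM mulf_eq0 negb_or => /andP[].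
Qed.

Definition ekey (k : positive) : ext F := ebasis F (set_of_bits (bits k)).

Definition sem (v : svec) : ext F := \sum_(q <- v) zF q.2 *: ekey q.1.

Lemma sem_cons k c v : sem ((k, c) :: v) = zF c *: ekey k + sem v.
Proof. by rewrite /sem big_cons. Qed.

Lemma sem_scale a v : sem (scale a v) = zF a *: sem v.
Proof.
elim: v => [|[k c] v IHv] /=; first by rewrite /sem !big_nil scaler0.
by rewrite !sem_cons IHv zFM scalerDr scalerA.
Qed.

Lemma sem_lin a v b w : sem (lin a v b w) = zF a *: sem v + zF b *: sem w.
Proof.
elim: v w => [|[k c] v IHv] w.
  by rewrite /= sem_scale [X in zF a *: X]big_nil scaler0 add0r.
elim: w => [|[l e] w IHw].
  rewrite /= sem_cons -/(scale a v) sem_scale zFM [sem [::]]big_nil scaler0 addr0.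
  by rewrite sem_cons scalerDr scalerA.
rewrite [lin _ _ _ _]/=; case: Pos.compare_spec => [<- | _ | _].
(* The [match] only drops an entry whose coefficient is zero, which contributes nothing to [sem]. *)
- have -> : sem match Z.add (Z.mul a c) (Z.mul b e) with
            | Z0 => lin a v b w | s => (k, s) :: lin a v b w end
         = zF (Z.add (Z.mul a c) (Z.mul b e)) *: ekey k + sem (lin a v b w).
    case: (Z.add _ _) => [|p|p]; rewrite ?sem_cons //.
    by rewrite /zF /= scale0r add0r.
  rewrite IHv !sem_cons zFD !zFM !scalerDr !scalerA scalerDl.
  by rewrite !addrA; congr (_ + _); rewrite -!addrA; congr (_ + _); rewrite addrC.
- by rewrite sem_cons IHv [sem ((k, c) :: _)]sem_cons zFM scalerDr scalerA addrA.
- rewrite sem_cons [X in _ + sem X]/= -/(lin a ((k, c) :: v) b w) IHw.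
  by rewrite [sem ((l, e) :: _)]sem_cons zFM scalerDr scalerA addrCA.
Qed.

Lemma sem_coef_eq0 k v :
    size (bits k) = 16%N -> all (fun q => size (bits q.1) == 16) v ->
    all (fun q => Pos.ltb k q.1) v ->
  sem v (set_of_bits (bits k)) = 0.
Proof.
move=> size_k size_v lt_k; rewrite sum_ffunE big1_seq // => q /andP[_ q_in].
rewrite ffunE ebasisE; case: eqP => [/set_of_bits_inj | _]; last by rewrite [_ *: _]mulr0.
move/allP/(_ q q_in)/eqP: size_v => size_q /(_ size_k size_q)/(can_inj bitsK) eq_k.
by move/allP/(_ q q_in): lt_k; rewrite eq_k Pos.ltb_irrefl.
Qed.

Lemma pivot_coef_lead w : pivot w -> sem w (set_of_bits (bits (lead w))) != 0.
Proof.
case: w => // -[k c] t /= /and4P[/unit2_neq0 c0 lt_k /eqP size_k size_t].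
by rewrite sem_cons ffunE sem_coef_eq0 // addr0 ffunE ebasisE eqxx [_ *: _]mulr1.
Qed.

Lemma pivot_coef_lt k w :
    size (bits k) = 16%N -> pivot w -> Pos.lt k (lead w) ->
  sem w (set_of_bits (bits k)) = 0.
Proof.
move=> size_k; case: w => // -[l c] t /and3P[_ lt_l size_w] /= lt_kl.
apply: sem_coef_eq0 => //=; rewrite (introT (Pos.ltb_spec0 _ _) lt_kl) /=.
apply: sub_all lt_l => q /Pos.ltb_spec0 lt_lq.
by apply/Pos.ltb_spec0; apply: Pos.lt_trans lt_lq.
Qed.

Lemma pivot_lead_size w : pivot w -> size (bits (lead w)) = 16%N.
Proof. by case: w => // -[k c] t /= /and4P[_ _ /eqP]. Qed.

(** Echelon form: once the rows are sorted by leading key, the leading coordinate of each row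
    vanishes on all later ones. Freeness is invariant under this permutation. *)
Lemma free_pivots (L : seq svec) :
  all pivot L -> uniq (map lead L) -> free (map sem L).
Proof.
pose r v w := Pos.leb (lead v) (lead w).
have r_total : total r.
  move=> v w; rewrite /r; case: Pos.leb_spec => //= /Pos.lt_le_incl le_wv.
  exact/Pos.leb_spec0.
have r_trans : transitive r.
  move=> v u w /Pos.leb_spec0 le_uv /Pos.leb_spec0 le_vw.
  by apply/Pos.leb_spec0; apply: Pos.le_trans le_vw.
have perm_L : perm_eq (sort r L) L by rewrite perm_sort.
rewrite -(perm_free (perm_map sem perm_L)) -(perm_all _ perm_L).
rewrite -(perm_uniq (perm_map lead perm_L)).
elim: (sort r L) (sort_sorted r_total L) => [|w s IHs] /=; first by rewrite nil_free.
move=> r_s /andP[piv_w piv_s] /andP[w_s uniq_s].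
apply: (@free_cons_coef _ _ (set_of_bits (bits (lead w)))).
- exact: pivot_coef_lead.
- move=> _ /mapP[v s_v ->]; apply: pivot_coef_lt.
  + exact: pivot_lead_size.
  + exact: (allP piv_s).
  have /allP/(_ v s_v)/Pos.leb_spec0/Pos.le_lteq[//|eq_wv] := order_path_min r_trans r_s.
  by rewrite eq_wv map_f in w_s.
- exact: IHs (path_sorted r_s) piv_s uniq_s.
Qed.

(** No division takes place: each step multiplies the vector by the leading coefficient of a pivot
    row before subtracting a multiple of that row. The factor [u] is the product of these
    coefficients, all units in [F]. *)
Lemma reduce_span fuel st v :
    coherent st ->
  exists2 u, u != 0 & sem (reduce fuel st.1 v) - u *: sem v \in <<map sem st.2>>%VS.
Proof.
case=> findL _ piv_L _.
have same v' : exists2 u, u != 0 & sem v' - u *: sem v' \in <<map sem st.2>>%VS.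
  by exists 1; rewrite ?oner_eq0 // scale1r subrr mem0v.
elim: fuel v => [|fuel IHf] [|[k c] v] //=.
case find_k: (PositiveMap.find k st.1) => [[|[l e] w]|] //=.
have L_w := findL _ _ find_k; set w' := (l, e) :: w in L_w *.
have /and3P[unit_e _ _] := allP piv_L _ L_w.
have [u u0 red_in] := IHf (lin e ((k, c) :: v) (Z.opp c) w').
exists (u * zF e); first by rewrite mulf_neq0 ?unit2_neq0.
move: red_in; rewrite sem_lin scalerDr opprD addrA !scalerA => red_in.
by rewrite -(subrK ((u * zF (Z.opp c)) *: sem w') (_ - _)) memvD // memvZ // memv_span ?map_f.
Qed.

(** Modulo the span of the earlier rows, the reduced vector is a nonzero multiple of [v], so the two
    can be exchanged. If it is empty, [v] was already in that span. *)
Lemma insert_span st v st' :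
    coherent st -> insert st v = Some st' ->
  coherent st' /\ <<map sem st'.2>>%VS = <<sem v :: map sem st.2>>%VS.
Proof.
move=> coh_st; have [u u0] := reduce_span 1000 v coh_st.
rewrite /insert; move: (reduce _ _ _) => w /= red_in.
have eq_span : <<sem w :: map sem st.2>>%VS = <<sem v :: map sem st.2>>%VS.
  have red_in_cons y : sem w - u *: sem v \in <<y :: map sem st.2>>%VS.
    by rewrite (subvP _ _ red_in) // sub_span // => z; rewrite inE orbC => ->.
  have L_in_cons y z : z \in map sem st.2 -> z \in <<y :: map sem st.2>>%VS.
    by move=> L_z; rewrite memv_span // inE L_z orbT.
  apply/subv_anti/andP; split; apply/span_subvP => x;
    rewrite inE => /predU1P[->|/L_in_cons //].
  - rewrite -[X in X \in _](subrK (u *: sem v)) memvD //.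
    by rewrite memvZ ?memv_span ?mem_head.
  - have -> : sem v = u^-1 *: (sem w - (sem w - u *: sem v)).
      by rewrite opprB addrC subrK scalerA mulVf // scale1r.
    by rewrite memvZ // memvB // memv_span ?mem_head.
case: w => [|q w] in red_in eq_span *.
  case=> <-; split=> //; rewrite -eq_span span_cons [sem [::]]big_nil.
  apply/esym/addv_idPr; by rewrite -memvE mem0v.
set w' := q :: w in red_in eq_span *; case: ifP => // /andP[piv_w].
case find_w: PositiveMap.find => // _ [<-]; split=> //=.
case: coh_st => findL Lfind piv_L uniq_L; split=> /=.
- move=> k x; have [-> | /eqP neq_k] := eqVneq k (lead w').
    by rewrite PositiveMap.gss => -[->]; rewrite mem_head.
  by rewrite PositiveMap.gso // inE => /findL->; rewrite orbT.
- move=> x; rewrite inE => /predU1P[->|L_x]; first by rewrite PositiveMap.gss.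
  rewrite PositiveMap.gso ?Lfind // => eq_x.
  by move: (Lfind _ L_x); rewrite eq_x find_w.
- exact/andP.
- rewrite uniq_L andbT; apply/mapP=> -[x L_x eq_x].
  by move: (Lfind _ L_x); rewrite -eq_x find_w.
Qed.

Lemma insert_all_span st vs st' :
    coherent st -> insert_all st vs = Some st' ->
  coherent st' /\ <<map sem st'.2>>%VS = (<<map sem vs>> + <<map sem st.2>>)%VS.
Proof.
elim: vs st => [|v vs IHvs] st coh_st /=.
  by case=> <-; split=> //; rewrite span_nil add0v.
case ins_v: (insert st v) => [st1|//] /IHvs ins_vs.
have [coh_st1 span_st1] := insert_span coh_st ins_v.
have [coh_st' ->] := ins_vs coh_st1; split=> //.
by rewrite span_st1 !span_cons addvA [X in (X + _)%VS]addvC.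
Qed.

(** The pivot rows span the same space as the input and are free, so counting them gives the
    rank. *)
Lemma dim_span_insert_all vs st :
    insert_all (PositiveMap.empty _, [::]) vs = Some st ->
  \dim <<map sem vs>> = size st.2.
Proof.
move=> ins_vs; have coh0 : coherent (PositiveMap.empty svec, [::]).
  by split=> //= k w; rewrite PositiveMap.gempty.
have [[_ _ piv_L uniq_L] eq_span] := insert_all_span coh0 ins_vs.
have /eqP := free_pivots piv_L uniq_L.
by rewrite eq_span span_nil addv0 size_map.
Qed.

End Elimination.

Arguments lin : simpl never.

(** * The matrix of the differential in bit encoding *)

Fixpoint par (k : nat) (b : bitseq) : bool :=
  match k, b with k'.+1, x :: b' => x (+) par k' b' | _, _ => false end.

(** The parity [s] leaves out the [+ 1] in the exponent of [dterm], so a true [s] means coefficient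
    1. Terms are added through [lin], which merges them in key order. *)
Fixpoint row_from (ts : seq (nat * nat * nat)) (b : bitseq) : svec :=
  match ts with
  | [::] => [::]
  | (k, i, j) :: ts' =>
    if [&& nth false b k, ~~ nth false b i & ~~ nth false b j] then
      let b' := set_nth false (set_nth false (set_nth false b k false) j true) i true in
      let s := par k b (+) par i b (+) par j b (+) (j < i)%N in
      lin (Zpos 1) [:: (key b', if s then Zpos 1 else Zneg 1)] (Zpos 1) (row_from ts' b)
    else row_from ts' b
  end.

(* The order of the monomials matters: with the opposite one the elimination
   meets pivots that are not powers of 2. *)
Fixpoint monos (m n : nat) : seq bitseq :=
  match m with
  | 0%N => if n is 0%N then [:: [::]] else [::]
  | m'.+1 => (if n is n'.+1 then [seq true :: b | b <- monos m' n'] else [::]) ++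
             [seq false :: b | b <- monos m' n]
  end.

Definition rank_check (n : nat) (r : N) : bool :=
  if insert_all (PositiveMap.empty _, [::]) (map (row_from triples) (monos 16 n)) is Some st
  then N.eqb (foldl (fun m _ => N.succ m) N0 st.2) r else false.

Lemma mem_monos m n b : (b \in monos m n) = (size b == m) && (count id b == n).
Proof.
elim: m n b => [|m IHm] n b /=; first by case: n b => [|n] [].
have tcons x (s : seq bitseq) : (b \in [seq x :: c | c <- s]) =
    if b is y :: c then (y == x) && (c \in s) else false.
  apply/mapP/idP => [[c s_c ->]|]; first by rewrite eqxx.
  by case: b => // y c /andP[/eqP-> s_c]; exists c.
rewrite mem_cat; case: n => [|n]; rewrite !tcons ?in_nil /=; case: b {tcons} => //= -[] b;
  by rewrite /= ?IHm ?eqSS ?add0n ?andbF ?orbF.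
Qed.

Lemma card_bits_take b k : size b = 16%N -> (k <= 16)%N ->
  #|[set s in set_of_bits b | (s < k)%N]| = count id (take k b).
Proof.
move=> size_b le_k; rewrite -sum1_count (big_nth false) size_takel ?size_b //.
rewrite (big_nat_widen _ _ 16) // big_mkord -sum1_card; apply: eq_bigl => s.
by rewrite !inE andbC [RHS]andbC; case: ltnP => //= lt_s; rewrite nth_take.
Qed.

Lemma card_bits b : size b = 16%N -> #|set_of_bits b| = count id b.
Proof.
move=> size_b; rewrite -[in RHS](take_size b) -card_bits_take ?size_b //.
by apply: eq_card => s; rewrite !inE ltn_ord andbT.
Qed.

Lemma odd_below b (i : gidx) :
  size b = 16%N -> odd (below i (set_of_bits b)) = par i b.
Proof.
move=> size_b; rewrite /below card_bits_take 1?ltnW //.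
elim: (nat_of_ord i) b {size_b} => [|k IHk] [|x b] //=.
by rewrite oddD IHk; case: x.
Qed.

Section Rank.
Variable F : fieldType.

Lemma dterm_row (k i j : nat) b :
    [&& k < 16, i < 16 & j < 16]%N -> size b = 16%N ->
  dterm F (k, i, j) (set_of_bits b) =
  if [&& nth false b k, ~~ nth false b i & ~~ nth false b j] then
    zF F (if par k b (+) par i b (+) par j b (+) (j < i)%N then Zpos 1 else Zneg 1) *:
    ekey F (key (set_nth false (set_nth false (set_nth false b k false) j true) i true))
  else 0.
Proof.
case/and3P=> lt_k lt_i lt_j size_b; rewrite /dterm /= !inE !inordK //.
case: ifP => // _; congr (_ *: _).
  rewrite -signr_odd !oddD /= !odd_below // !inordK // oddb.
  by case: (par k b); case: (par i b); case: (par j b); case: (j < i)%N.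
rewrite /ekey keyK; congr (ebasis F _); apply/setP=> s; rewrite !inE !nth_set_nth /=.
by rewrite -!val_eqE /= !inordK // nth_set_nth /= nth_set_nth /=; do 3?case: eqP.
Qed.

Lemma sem_row_from ts b :
    size b = 16%N -> all (fun t => [&& t.1.1 < 16, t.1.2 < 16 & t.2 < 16]%N) ts ->
  sem F (row_from ts b) = \sum_(t <- ts) dterm F t (set_of_bits b).
Proof.
move=> size_b; elim: ts => [|[[k i] j] ts IHts] /=; first by rewrite /sem !big_nil.
case/andP=> lt_t /IHts eq_ts; rewrite big_cons dterm_row //.
case: ifP => _; last by rewrite add0r.
by rewrite sem_lin !scale1r sem_cons [sem F [::]]big_nil addr0 eq_ts.
Qed.

Lemma Vdeg_monos n : Vdeg F n = <<[seq ebasis F (set_of_bits b) | b <- monos 16 n]>>%VS.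
Proof.
apply/eq_span => x; apply/mapP/mapP => -[].
  move=> S; rewrite mem_enum inE => /eqP nS ->.
  pose b := [seq i \in S | i <- enum gidx].
  have size_b : size b = 16%N by rewrite size_map -cardE card_ord.
  have eq_S : set_of_bits b = S.
    apply/setP=> i; rewrite inE (nth_map ord0) ?nth_ord_enum //.
    by rewrite -cardE card_ord.
  by exists b; rewrite ?eq_S // mem_monos size_b -card_bits // eq_S nS !eqxx.
move=> b; rewrite mem_monos => /andP[/eqP size_b /eqP nb] ->.
by exists (set_of_bits b); rewrite // mem_enum inE card_bits // nb.
Qed.

Hypothesis F2 : 2%:R != 0 :> F.

(** The rows computed by [row_from] are the images under d of the degree n monomials, so the number
    of pivots is the dimension of the image. *)
Lemma drank_check n r : rank_check n r -> drank F n = nat_of_bin r.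
Proof.
rewrite /rank_check; case ins: insert_all => [st|] // /N.eqb_spec <-.
rewrite /drank Vdeg_monos limg_span -map_comp.
have eq_rows : [seq (dlin F \o (fun b => ebasis F (set_of_bits b))) b | b <- monos 16 n]
             = map (sem F) (map (row_from triples) (monos 16 n)).
  rewrite -map_comp; apply/eq_in_map => b; rewrite mem_monos => /andP[/eqP size_b _].
  change (dlin F (ebasis F (set_of_bits b)) = sem F (row_from triples b)).
  by rewrite dlinE dfun_ebasis dbasisE sem_row_from.
rewrite eq_rows (dim_span_insert_all F2 ins).
have addK (T : Type) (s : seq T) m :
    nat_of_bin (foldl (fun m _ => N.succ m) m s) = (nat_of_bin m + size s)%N.
  elim: s m => [|y s IHs] m /=; first by rewrite addn0.
  by rewrite IHs; lia.
by rewrite addK.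
Qed.

End Rank.

(** * The numerical ranks and the Poincaré polynomial *)

Definition ranks : seq N :=
  [:: 0; 6; 66; 323; 1036; 2356; 3981; 5156; 5156; 3981; 2356; 1036; 323; 66; 6; 0; 0]%num.

Definition betti : seq nat :=
  [:: 1; 10; 48; 171; 461; 976; 1671; 2303; 2558; 2303; 1671; 976; 461; 171; 48; 10; 1]%N.

(** A closed integer computation that mentions no field: one run, evaluated by the virtual machine,
    serves every characteristic other than 2. *)
Lemma ranks_check : all (fun n => rank_check n (nth N0 ranks n)) (iota 0 17).
Proof. by vm_cast_no_check (erefl true). Qed.

Lemma betti_ranks :
  all (fun n => 'C(16, n.+1) - nth N0 ranks n.+1 - nth N0 ranks n == nth 0 betti n.+1)%N
      (iota 0 16).
Proof. by vm_cast_no_check (erefl true). Qed.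

Lemma coh_dim_betti (F : fieldType) n :
  2%:R != 0 :> F -> (n < 17)%N -> coh_dim F n = nth 0%N betti n.
Proof.
move=> F2 lt_n; have drankE m : (m < 17)%N -> drank F m = nth N0 ranks m.
  move=> lt_m; apply: (drank_check F2); apply: (allP ranks_check).
  by rewrite mem_iota.
(* Degree 0 stands apart because no differential enters it. *)
case: n lt_n => [|n] lt_n; first by rewrite coh_dim0 drankE.
rewrite coh_dimS (drankE _ lt_n) (drankE _ (ltnW lt_n)).
by have /allP/(_ n) := betti_ranks; rewrite mem_iota => /(_ lt_n)/eqP.
Qed.

Theorem theorem5p8 (p : nat) (hp : prime p) (hp3 : (3 < p)%N) :
  poincare 'F_p =
    (1 + 'X) ^+ 4 *
    (1 + 6 *: 'X + 18 *: 'X^2 + 59 *: 'X^3 + 92 *: 'X^4 + 176 *: 'X^5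
       + 161 *: 'X^6 + 176 *: 'X^7 + 92 *: 'X^8 + 59 *: 'X^9 + 18 *: 'X^10
       + 6 *: 'X^11 + 'X^12)
  /\ [seq coh_dim 'F_p n | n <- iota 0 10]
       = [:: 1; 10; 48; 171; 461; 976; 1671; 2303; 2558; 2303]%N
  /\ coh_dim 'F_p 16 = 1%N.
Proof.
(* If 2 vanished, p would divide 2, against p > 3. *)
have F2 : 2%:R != 0 :> 'F_p.
  rewrite -(dvdn_pcharf (pchar_Fp hp)); apply: contraL hp3 => /dvdn_leq le_p2.
  by rewrite -leqNgt ltnW // ltnS le_p2.
have dimE n : (n < 17)%N -> coh_dim 'F_p n = nth 0%N betti n by apply: coh_dim_betti.
split; last by rewrite [map _ _]/= !dimE.
rewrite /poincare.
under eq_bigr => n _ do rewrite dimE //.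
(* What remains is an identity of explicit integer polynomials; writing scalars as repeated addition
   puts it in a form that [ring] accepts. *)
rewrite !big_ord_recl big_ord0 /= /bump /=.
rewrite !scaler_nat.
ring.
Qed.
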